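(* Let $(L_1,\leq_1,\ast_1,e_1,\multimap_1)$ and $(L_2,\leq_2,\ast_2,e_2,\multimap_2)$ be lineales. Then $L_1\times L_2$ has a lineale structure $(L_1\times L_2,\leq,\ast,e,\multimap)$ where, for $l=(l_1,l_2)$ and $l'=(l'_1,l'_2)$ in $L_1\times L_2$: the product is $l\ast l'=(l_1\ast_1 l'_1,\;l_2\ast_2 l'_2)$; the unit is $e=(e_1,e_2)$; $l\leq l'$ holds if and only if $l_1\leq_1 l'_1$ and $l_2\leq_2 l'_2$; and the internal-hom is $l\multimap l'=(l_1\multimap_1 l'_1,\;l_2\multimap_2 l'_2)$. Moreover, this operation is the (binary) product in the category $\mathsf{Lin}$ of lineales.
   Context: A partially ordered commutative monoid $(L,\leq,\ast,e)$ is a commutative monoid $(L,\ast,e)$ with a partial order $\leq$ such that $a\leq b$ and $a'\leq b'$ imply $a\ast a'\leq b\ast b'$. A lineale $(L,\leq,\ast,e,\multimap)$ is a partially ordered commutative monoid with a binary operation $\multimap$ (internal-hom) such that for all $a,b,c\in L$: $b\ast c\leq a\iff b\leq c\multimap a$; and if $b\leq a$ and $a'\leq b'$ then $a\multimap a'\leq b\multimap b'$. A morphism of lineales $h:(L,\leq,\ast,e,\multimap)\to(L',\leq',\ast',e',\multimap')$ is a monotone function $h:(L,\leq)\to(L',\leq')$ such that $e'\leq' h(e)$ and $h(a)\ast' h(b)\leq' h(a\ast b)$ for all $a,b\in L$. Lineales and their morphisms form the category $\mathsf{Lin}$. *)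

(* Defs.v *)
From Corelib Require Import ssreflect ssrfun.
From Stdlib Require Import Relation_Definitions FunctionalExtensionality
  ProofIrrelevance.

Set Implicit Arguments.
Unset Strict Implicit.
Unset Printing Implicit Defensive.

Record is_po_comm_monoid (L : Type) (le : relation L) (mul : L -> L -> L)
    (e : L) : Prop := {
  po_order : order L le;
  po_mulA : associative mul;
  po_mulC : commutative mul;
  po_mul1 : left_id e mul;
  po_mul_mono : forall a b a' b', le a b -> le a' b' ->
    le (mul a a') (mul b b')
}.

Record is_lineale (L : Type) (le : relation L) (mul : L -> L -> L) (e : L)
    (imp : L -> L -> L) : Prop := {
  lineale_monoid : is_po_comm_monoid le mul e;
  lineale_adj : forall a b c, le (mul b c) a <-> le b (imp c a);
  lineale_imp_mono : forall a b a' b', le b a -> le a' b' ->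
    le (imp a a') (imp b b')
}.

Record lineale : Type := Lineale {
  carrier :> Type;
  lle : relation carrier;
  lmul : carrier -> carrier -> carrier;
  lunit : carrier;
  limp : carrier -> carrier -> carrier;
  lineale_ax : is_lineale lle lmul lunit limp
}.

Arguments lle {l} _ _.
Arguments lmul {l} _ _.
Arguments lunit {l}.
Arguments limp {l} _ _.

Record lin_hom (L L' : lineale) : Type := LinHom {
  lin_fun :> L -> L';
  lin_mono : forall a b, lle a b -> lle (lin_fun a) (lin_fun b);
  lin_unit : lle lunit (lin_fun lunit);
  lin_mul : forall a b,
    lle (lmul (lin_fun a) (lin_fun b)) (lin_fun (lmul a b))
}.

Lemma lin_hom_eq (L L' : lineale) (f g : lin_hom L L') : f =1 g -> f = g.
Proof.
case: f g => [f f1 f2 f3] [g g1 g2 g3] /= fg.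
have E : f = g by apply: functional_extensionality.
by subst g; f_equal; apply: proof_irrelevance.
Qed.

Lemma lle_refl (L : lineale) (a : L) : lle a a.
Proof. by case: (po_order (lineale_monoid (lineale_ax L))) => r _ _; apply: r. Qed.

Lemma lle_trans (L : lineale) (b a c : L) : lle a b -> lle b c -> lle a c.
Proof. by case: (po_order (lineale_monoid (lineale_ax L))) => _ t _; apply: t. Qed.

Definition lin_id (L : lineale) : lin_hom L L.
Proof.
refine {| lin_fun := fun a => a |} => //; last by move=> a b; apply: lle_refl.
exact: lle_refl.
Defined.

Definition lin_comp (L L' L'' : lineale) (g : lin_hom L' L'')
  (f : lin_hom L L') : lin_hom L L''.
Proof.
refine {| lin_fun := fun a => g (f a) |}.
- by move=> a b ab; do 2!apply: lin_mono.
- by apply: lle_trans (lin_unit g) _; apply: lin_mono; apply: lin_unit.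
- by move=> a b; apply: lle_trans (lin_mul g _ _) _; apply: lin_mono;
  apply: lin_mul.
Defined.

Record category : Type := Category {
  obj : Type;
  hom : obj -> obj -> Type;
  idm : forall X, hom X X;
  comp : forall X Y Z, hom Y Z -> hom X Y -> hom X Z;
  comp_idl : forall X Y (f : hom X Y), comp (idm Y) f = f;
  comp_idr : forall X Y (f : hom X Y), comp f (idm X) = f;
  compA : forall X Y Z W (h : hom Z W) (g : hom Y Z) (f : hom X Y),
    comp h (comp g f) = comp (comp h g) f
}.

Arguments hom {c} _ _.
Arguments comp {c X Y Z} _ _.

Definition is_binary_product (C : category) (A B P : obj C)
    (p1 : hom P A) (p2 : hom P B) : Prop :=
  forall (X : obj C) (f : hom X A) (g : hom X B),
    exists! h : hom X P, comp p1 h = f /\ comp p2 h = g.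

Arguments is_binary_product : clear implicits.

Definition Lin : category.
Proof.
refine {| obj := lineale; hom := lin_hom; idm := lin_id; comp := lin_comp |};
  by move=> *; apply: lin_hom_eq.
Defined.

Definition prod_le (L1 L2 : lineale) (l l' : L1 * L2) : Prop :=
  lle (fst l) (fst l') /\ lle (snd l) (snd l').

Definition prod_mul (L1 L2 : lineale) (l l' : L1 * L2) : L1 * L2 :=
  (lmul (fst l) (fst l'), lmul (snd l) (snd l')).

Definition prod_unit (L1 L2 : lineale) : L1 * L2 := (lunit, lunit).

Definition prod_imp (L1 L2 : lineale) (l l' : L1 * L2) : L1 * L2 :=
  (limp (fst l) (fst l'), limp (snd l) (snd l')).

Arguments prod_le : clear implicits.
Arguments prod_mul : clear implicits.
Arguments prod_unit : clear implicits.
Arguments prod_imp : clear implicits.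

(* Main.v *)
Require Import Defs.
From Corelib Require Import ssreflect ssrfun.
From Stdlib Require Import Relation_Definitions.

Set Implicit Arguments.
Unset Strict Implicit.
Unset Printing Implicit Defensive.

(** Order and operations are componentwise, so each lineale law is a pair of instances, one in [L1]
    and one in [L2] ([prod_is_lineale]). For the same reason the set-theoretic projections and
    pairing are monotone and lax monoidal. Since morphisms are equal when they agree pointwise
    ([lin_hom_eq]), the universal property reduces to that of the cartesian product of sets. *)

Lemma prod_le_order (L1 L2 : lineale) : order (L1 * L2) (prod_le L1 L2).
Proof.
have [_ _ as1] := po_order (lineale_monoid (lineale_ax L1)).
have [_ _ as2] := po_order (lineale_monoid (lineale_ax L2)).
split.
- by move=> l; split; apply: lle_refl.
- by move=> l m n [lm1 lm2] [mn1 mn2];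
    split; [apply: lle_trans lm1 mn1 | apply: lle_trans lm2 mn2].
- move=> [a b] [a' b'] [/= aa' bb'] [/= a'a b'b].
  by rewrite (as1 _ _ aa' a'a) (as2 _ _ bb' b'b).
Qed.

Lemma prod_is_po_comm_monoid (L1 L2 : lineale) :
  is_po_comm_monoid (prod_le L1 L2) (prod_mul L1 L2) (prod_unit L1 L2).
Proof.
have [_ A1 C1 I1 M1] := lineale_monoid (lineale_ax L1).
have [_ A2 C2 I2 M2] := lineale_monoid (lineale_ax L2).
split.
- exact: prod_le_order.
- by move=> l m n; rewrite /prod_mul /= A1 A2.
- by move=> l m; rewrite /prod_mul C1 C2.
- by move=> [a b]; rewrite /prod_mul /= I1 I2.
- by move=> a b a' b' [ab1 ab2] [ab1' ab2']; split; [apply: M1 | apply: M2].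
Qed.

Lemma prod_is_lineale (L1 L2 : lineale) :
  is_lineale (prod_le L1 L2) (prod_mul L1 L2) (prod_unit L1 L2)
    (prod_imp L1 L2).
Proof.
have [_ adj1 mono1] := lineale_ax L1.
have [_ adj2 mono2] := lineale_ax L2.
split.
- exact: prod_is_po_comm_monoid.
(* The adjunction is a conjunction of two equivalences, so the same views serve in both
   directions. *)
- by move=> a b c; split=> -[/adj1 h1 /adj2 h2]; split.
- by move=> a b a' b' [ba1 ba2] [ab1 ab2];
    split; [apply: mono1 | apply: mono2].
Qed.

Definition prod_lineale (L1 L2 : lineale) : lineale :=
  Lineale (prod_is_lineale L1 L2).

(** Projections preserve unit and multiplication strictly, so both lax inequalities are reflexivity.
    The transparent body lets the projection compute to [fst]. *)
Definition lin_fst (L1 L2 : lineale) : lin_hom (prod_lineale L1 L2) L1.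
Proof.
refine {| lin_fun := fun l : prod_lineale L1 L2 => fst l |}.
- by move=> a b [].
- exact: lle_refl.
- by move=> a b; apply: lle_refl.
Defined.

Definition lin_snd (L1 L2 : lineale) : lin_hom (prod_lineale L1 L2) L2.
Proof.
refine {| lin_fun := fun l : prod_lineale L1 L2 => snd l |}.
- by move=> a b [].
- exact: lle_refl.
- by move=> a b; apply: lle_refl.
Defined.

(** The mediating morphism: each condition in the product order splits into that condition for [f]
    and for [g]. *)
Definition lin_pair (L1 L2 X : lineale) (f : lin_hom X L1) (g : lin_hom X L2) :
  lin_hom X (prod_lineale L1 L2).
Proof.
refine {| lin_fun := fun x => (f x, g x) : prod_lineale L1 L2 |}.
- by move=> a b ab; split; apply: lin_mono.
- by split; apply: lin_unit.
- by move=> a b; split; apply: lin_mul.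
Defined.

Lemma prod_lineale_is_binary_product (L1 L2 : lineale) :
  is_binary_product Lin L1 L2 (prod_lineale L1 L2)
    (lin_fst L1 L2) (lin_snd L1 L2).
Proof.
move=> X f g; exists (lin_pair f g); split.
  by split; apply: lin_hom_eq.
(* Replacing [f] and [g] by the composites of [h] with the projections reduces uniqueness to
   surjective pairing at [h x]. *)
move=> h [<- <-]; apply: lin_hom_eq => x /=.
by case: (lin_fun h x).
Qed.

Theorem proposition2p14 (L1 L2 : lineale) :
  exists H : is_lineale (prod_le L1 L2) (prod_mul L1 L2) (prod_unit L1 L2)
      (prod_imp L1 L2),
    let P : lineale := Lineale H in
    exists (p1 : lin_hom P L1) (p2 : lin_hom P L2),
      (forall l : L1 * L2, p1 l = fst l) /\
      (forall l : L1 * L2, p2 l = snd l) /\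
      is_binary_product Lin L1 L2 P p1 p2.
Proof.
(* With this witness [P] is convertible to [prod_lineale L1 L2], so the projections have the
   required type. *)
exists (prod_is_lineale L1 L2); exists (lin_fst L1 L2), (lin_snd L1 L2).
by split=> //; split=> //; apply: prod_lineale_is_binary_product.
Qed.
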